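(* Let $\hat F$ and $\hat E$ be Hermitian operators on $\mathcal H=\mathbb C^2$, each having eigenvalues $+1$ and $-1$, and suppose $[\hat F,\hat E]\neq 0$. Let $\omega_E,\omega_F>0$ with $\omega_E\neq\omega_F$, and put $H=\omega_E\hat E+\omega_F\hat F$ and $\hat Z=-i[\hat F,\hat E]$. Then $H$ is invertible and, for every $t\geq 0$, setting $$\rho(t,H)=\frac{e^{2itH}-1}{2i}\,H^{-1},$$ one has $$e^{iHt}\hat F e^{-iHt}=\hat F+\omega_E\,\rho(t,H)\,\hat Z,\qquad e^{iHt}\hat E e^{-iHt}=\hat E-\omega_F\,\rho(t,H)\,\hat Z .$$ Consequently, for every $\Psi_0\in\mathcal H$ with $\|\Psi_0\|=1$, writing $\Psi(t)=e^{-iHt}\Psi_0$, $$\langle\Psi(t),\hat F\Psi(t)\rangle=\langle\Psi_0,\hat F\Psi_0\rangle+\frac{\omega_E}{2i}\left\langle\Psi_0,\left(e^{2itH}-1\right)H^{-1}\hat Z\,\Psi_0\right\rangle,$$ $$\langle\Psi(t),\hat E\Psi(t)\rangle=\langle\Psi_0,\hat E\Psi_0\rangle-\frac{\omega_F}{2i}\left\langle\Psi_0,\left(e^{2itH}-1\right)H^{-1}\hat Z\,\Psi_0\right\rangle .$$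
   Context: $\mathcal H=\mathbb C^2$ carries its standard scalar product $\langle\cdot,\cdot\rangle$, linear in the second variable. $[A,B]=AB-BA$. In $e^{2itH}-1$, the symbol $1$ denotes the identity operator on $\mathcal H$. *)

(* Defs.v *)
From mathcomp Require Import all_boot all_order all_algebra.
From mathcomp Require Import complex.
From mathcomp Require Import all_classical all_reals all_analysis.

Set Implicit Arguments.
Unset Strict Implicit.
Unset Printing Implicit Defensive.

Import Order.TTheory GRing.Theory Num.Theory.
Import numFieldNormedType.Exports.

Local Open Scope classical_set_scope.
Local Open Scope ring_scope.
Local Open Scope complex_scope.
Local Open Scope sesquilinear_scope.

(* The matrix exponential, as the sum of the series A^k / k!; the limit is
   taken for the (entrywise) topology on matrices induced by the norm of K. *)
Definition expmx (K : numFieldType) (n : nat) (A : 'M[K]_n.+1) : 'M[K]_n.+1 :=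
  lim (series (fun k : nat => (k`!%:R : K)^-1 *: A ^+ k) @ \oo).

Definition commutator (K : pzRingType) (n : nat) (A B : 'M[K]_n) : 'M[K]_n :=
  A *m B - B *m A.

(* Standard scalar product on column vectors, conjugate-linear in u and linear
   in v (whereas dotmx acts on row vectors and is linear in its first
   argument). *)
Definition cdot (C : numClosedFieldType) (n : nat) (u v : 'cV[C]_n) : C :=
  (u^t* *m v) 0 0.

(* Euclidean norm; the norm that 'cV[C]_n carries as a normed module is the
   sup norm. *)
Definition cnorm (C : numClosedFieldType) (n : nat) (u : 'cV[C]_n) : C :=
  sqrtC (cdot u u).

Definition rho (R : realType) (n : nat) (t : R) (H : 'M[R[i]]_n.+1)
    : 'M[R[i]]_n.+1 :=
  ((2 * 'i)^-1 *: (expmx ((2 * 'i * t%:C) *: H) - 1%:M)) *m invmx H.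

(* Main.v *)
Require Import Defs.
From mathcomp Require Import all_boot all_order all_algebra.
From mathcomp Require Import complex.
From mathcomp Require Import all_classical all_reals all_analysis.
From mathcomp Require Import ring.

(** On C^2 the operators F and E are traceless with square 1, so H^2 is a scalar
    w^2 with w real, and w != 0 because wE != wF.  Hence J := i H / w satisfies
    J^2 = -1, and e^{itH} = cos(tw) + sin(tw) J by comparing power series.

    No differentiation in t is needed.  Since F^2 = E^2 = 1, the commutator
    [F, E] anticommutes with F and E, hence with H; so does
    L := (2i)^-1 H^-1 Z, and H L = - [F, E] / 2 shows that F - wE L and
    E + wF L commute with H.  Conjugation by e^{itH} therefore fixes the latter
    two and multiplies L on the left by e^{2itH}. *)

Set Implicit Arguments.
Unset Strict Implicit.
Unset Printing Implicit Defensive.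

Import Order.TTheory GRing.Theory Num.Theory.
Import numFieldNormedType.Exports.
Local Open Scope ring_scope.
Local Open Scope complex_scope.

(** * Real limits in [R[i]] and powers of a matrix with scalar square *)

Lemma cvg_real_complex (R : realType) (u : nat -> R) (l : R) :
  (u @ \oo --> l)%classic ->
  ((fun n => (u n)%:C : (R[i] : numFieldType)) @ \oo
     --> (l%:C : (R[i] : numFieldType)))%classic.
Proof.
move=> ul; apply/cvgrPdist_lt => e e0.
(* A positive element of [R[i]] is real, so the estimate reduces to one in [R]. *)
have [e1 eE] : 0 < complex.Re e /\ e = (complex.Re e)%:C.
  by move: e e0 => [a b]; rewrite ltcE /= => /andP[/eqP -> ->].
move/cvgrPdist_lt : ul => /(_ _ e1); apply: filterS => n.
by rewrite -rmorphB eE normc_def/= expr0n addr0 sqrtr_sqr ltcR.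
Qed.

(** Both parities stand in one formula, with 0-1 coefficients, to match [cos_coeff] and [sin_coeff]
    term by term. *)
Lemma exprmx_square_root_scalar (R : comPzRingType) (n : nat)
    (A : 'M[R]_n.+1) (a : R) (k : nat) :
  A *m A = a%:M ->
  A ^+ k = (~~ odd k)%:R *: (a ^+ k./2)%:M + (odd k)%:R *: (a ^+ k./2 *: A).
Proof.
move=> A2; elim: k => [|k IHk].
  by rewrite /= expr0 scale1r scale0r addr0.
rewrite exprS IHk /= uphalf_half -mulmxE mulmxDr -!scalemxAr A2 mul_mx_scalar.
case: (odd k); rewrite /= ?scale0r ?scale1r ?add0r ?addr0 //.
by rewrite scale_scalar_mx -exprSr.
Qed.

(** * Exponential of a matrix of square -1 *)

Section ComplexStructure.
Variables (R : realType) (n : nat) (J : 'M[R[i]]_n.+1).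
Hypothesis JJ : J *m J = (-1)%:M.

Let e (x : R) := expmx (x%:C *: J).

(** Euler's formula: the powers of [J] run through ±1 and ±[J], so even and odd terms of the
    exponential series sum to cosine and sine. *)
Lemma expmx_complex_structure x :
  e x = (cos x)%:C *: 1%:M + (sin x)%:C *: J.
Proof.
apply: cvg_lim; first exact: norm_hausdorff.
have -> : series (fun k : nat => (k`!%:R : R[i])^-1 *: (x%:C *: J) ^+ k)
  = (fun k => (series (cos_coeff x) k)%:C *: (1%:M : 'M[R[i]]_n.+1)
              + (series (sin_coeff x) k)%:C *: J).
  apply/funext => m; rewrite /series /= !rmorph_sum !scaler_suml -big_split /=.
  apply: eq_bigr => k _; rewrite exprZn (exprmx_square_root_scalar k JJ).
  rewrite /cos_coeff /sin_coeff /= -scalemx1.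
  rewrite !scalerDr !scalerA; congr (_ *: _ + _ *: _).
    by rewrite !rmorphM fmorphV !rmorphXn !rmorph_nat rmorphN1; ring.
  (* [sin_coeff] has the exponent [k.-1./2] where the power of [J] gives [k./2]; they agree for odd
     [k], and for even [k] the coefficient is 0. *)
  case: k => [|k]; first by rewrite /= !(mul0r, mulr0, rmorph0).
  rewrite !rmorphM !fmorphV !rmorphXn !rmorph_nat rmorphN1 /= uphalf_half.
  by case: (odd k) => /=; rewrite ?add0n; ring.
have cosx : (series (cos_coeff x) @ \oo --> cos x)%classic.
  by rewrite cos.unlock; exact: is_cvg_series_cos_coeff.
have sinx : (series (sin_coeff x) @ \oo --> sin x)%classic.
  by rewrite sin.unlock; exact: is_cvg_series_sin_coeff.
apply: cvgD.
  exact: (@cvgZr_tmp _ 'M[R[i]]_n.+1 _ _ _ _ _ _ (cvg_real_complex cosx)).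
exact: (@cvgZr_tmp _ 'M[R[i]]_n.+1 _ _ _ _ _ _ (cvg_real_complex sinx)).
Qed.

Let eE := expmx_complex_structure.

Lemma expmx_complex_structureD x y : e (x + y) = e x *m e y.
Proof.
rewrite !eE cosD sinD !rmorphB !rmorphD !rmorphM mulmxDl !mulmxDr.
rewrite -!scalemxAl -!scalemxAr !mul1mx !mulmx1 JJ -(scalemx1 _ (-1)) !scalerA.
by apply/matrixP => i j; rewrite !mxE; ring.
Qed.

Lemma expmx_complex_structure0 : e 0 = 1%:M.
Proof. by rewrite eE cos0 sin0 scale1r scale0r addr0. Qed.

Lemma expmx_complex_structure_comm A x : A *m J = J *m A -> A *m e x = e x *m A.
Proof.
move=> AJ; rewrite eE mulmxDr mulmxDl -!scalemxAl -!scalemxAr AJ.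
by rewrite mul1mx mulmx1.
Qed.

(** Crossing [A] flips only the sine term, which amounts to changing the sign of [x]. *)
Lemma expmx_complex_structure_anticomm A x :
  A *m J = - (J *m A) -> A *m e x = e (- x) *m A.
Proof.
move=> AJ; rewrite !eE cosN sinN rmorphN.
rewrite mulmxDr mulmxDl -!scalemxAl -!scalemxAr AJ mul1mx mulmx1.
by rewrite scalerN scaleNr.
Qed.

Lemma adjoint_expmx_complex_structure x :
  (J^t* = - J -> (e x)^t* = e (- x))%sesqui.
Proof.
move=> Jadj; rewrite !eE cosN sinN rmorphN linearD /= !linearZ /= trmx1.
rewrite map_mxD !map_mxZ /= map_mx1 Jadj scalerN scaleNr.
congr (_ *: _ - _ *: _); exact: conjc_real.
Qed.

(* [A - a *: L] commutes with [J] while [L] anticommutes with it. *)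
Lemma expmx_complex_structure_conj A L (a : R[i]) x :
  L *m J = - (J *m L) -> J *m A - A *m J = (2 * a) *: (J *m L) ->
  e x *m A *m e (- x) = A + a *: ((e (2 * x) - 1%:M) *m L).
Proof.
move=> LJ JA.
have comm : (A - a *: L) *m J = J *m (A - a *: L).
  rewrite mulmxBl mulmxBr -scalemxAl -scalemxAr LJ scalerN opprK.
  rewrite -[J *m A](subrK (A *m J)) JA mulr_natl mulr2n scalerDl.
  by rewrite [in RHS]addrAC addrK addrC.
have -> : e x *m A = e x *m (A - a *: L) + a *: (e x *m L).
  by rewrite mulmxBr -scalemxAr subrK.
rewrite mulmxDl -(expmx_complex_structure_comm _ comm) -mulmxA.
rewrite -expmx_complex_structureD subrr expmx_complex_structure0 mulmx1.
(* Moved to the left across [L], the factor [e (- x)] becomes a second [e x], whence [e (2 * x)]. *)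
rewrite -scalemxAl -mulmxA (expmx_complex_structure_anticomm _ LJ) opprK mulmxA.
rewrite -expmx_complex_structureD.
by rewrite mulmxBl mul1mx scalerBr addrAC addrA mulr_natl mulr2n.
Qed.

End ComplexStructure.

(** * Two-by-two matrices with eigenvalues 1 and -1 *)

Lemma det_mx22 (R : comPzRingType) (A : 'M[R]_2) :
  \det A = A 0 0 * A 1 1 - A 0 1 * A 1 0.
Proof.
rewrite (expand_det_row _ 0) !big_ord_recl big_ord0 addr0 /cofactor !det_mx11.
rewrite !mxE /= expr0 expr1 mul1r mulN1r mulrN.
by congr (A _ _ * A _ _ - A _ _ * A _ _); apply/val_inj.
Qed.

Lemma mx2P (R : Type) (A B : 'M[R]_2) :
  A 0 0 = B 0 0 -> A 0 1 = B 0 1 -> A 1 0 = B 1 0 -> A 1 1 = B 1 1 -> A = B.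
Proof.
move=> h00 h01 h10 h11; apply/matrixP => i j.
have ord2 (k : 'I_2) : k = 0 \/ k = 1.
  by case: k => [[|[|//]] ?]; [left | right]; apply: val_inj.
by case: (ord2 i) => ->; case: (ord2 j) => ->.
Qed.

Lemma eigenvalue_det (F : fieldType) (n : nat) (A : 'M[F]_n) (a : F) :
  eigenvalue A a -> \det (A - a%:M) = 0.
Proof.
case/eigenvalueP => v vA v0; apply/eqP/det0P; exists v => //.
by rewrite mulmxBr vA mul_mx_scalar subrr.
Qed.

(** The determinants of [A - 1] and [A + 1] both vanish. Their difference is twice the trace, up to
    sign, so the trace is 0; either one then gives determinant -1. *)
Lemma eigenvalue_pm1_mx22 (F : numFieldType) (A : 'M[F]_2) :
  eigenvalue A 1 -> eigenvalue A (-1) ->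
  A 1 1 = - A 0 0 /\ A 0 0 ^+ 2 + A 0 1 * A 1 0 = 1.
Proof.
move=> /eigenvalue_det + /eigenvalue_det.
rewrite !det_mx22 !mxE /= !mulr1n !mulr0n !subr0 opprK => h1 h2.
have tr0 : A 1 1 = - A 0 0.
  have two : 2 != 0 :> F by rewrite pnatr_eq0.
  apply: (mulfI two).
  have : (A 0 0 + 1) * (A 1 1 + 1) - A 0 1 * A 1 0
    - ((A 0 0 - 1) * (A 1 1 - 1) - A 0 1 * A 1 0) = 0 by rewrite h1 h2 subrr.
  by move=> h; apply/eqP; rewrite -subr_eq0; apply/eqP; rewrite -[RHS]h; ring.
split=> //; apply/eqP; rewrite -subr_eq0; apply/eqP.
by rewrite -[RHS]oppr0 -h1 tr0; ring.
Qed.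

(** Cayley-Hamilton at trace 0; the scalar is [- \det A]. *)
Lemma sqr_traceless_mx22 (R : comPzRingType) (A : 'M[R]_2) :
  A 1 1 = - A 0 0 -> A *m A = (A 0 0 ^+ 2 + A 0 1 * A 1 0)%:M.
Proof.
move=> tr0.
have mulE i j : (A *m A) i j = A i 0 * A 0 j + A i 1 * A 1 j.
  rewrite mxE !big_ord_recl big_ord0 addr0.
  by congr (A _ _ * A _ _ + A _ _ * A _ _); apply: val_inj.
apply: mx2P; rewrite mulE mxE /= ?mulr0n ?mulr1n ?tr0; ring.
Qed.

(** * Hermitian matrices, commutators and the scalar product *)

Lemma hermsymmxE (C : numClosedFieldType) (n : nat) (A : 'M[C]_n) :
  A \is hermsymmx -> (A^t* = A)%sesqui.
Proof. by move/is_hermitianmxP => {2}->; rewrite expr0 scale1r. Qed.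

Lemma hermsymmx_conj (C : numClosedFieldType) (n : nat) (A : 'M[C]_n) i j :
  A \is hermsymmx -> A i j = (A j i)^*%R.
Proof. by move/hermsymmxE => {1}<-; rewrite !mxE. Qed.

(** Since [A] squares to 1, the product on the left is [A B A - B], while [A] times the commutator
    is [B - A B A]. *)
Lemma anticommutator_commutator (R : pzRingType) (n : nat) (A B : 'M[R]_n) :
  A *m A = 1%:M -> commutator A B *m A = - (A *m commutator A B).
Proof.
move=> AA; rewrite /commutator mulmxBl mulmxBr mulmxA AA mul1mx.
by rewrite -!mulmxA AA mulmx1 opprB.
Qed.

Lemma commutatorC (R : pzRingType) (n : nat) (A B : 'M[R]_n) :
  commutator A B = - commutator B A.
Proof. by rewrite /commutator opprB. Qed.

Lemma cdotDr (C : numClosedFieldType) (n : nat) (u v w : 'cV[C]_n) :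
  cdot u (v + w) = cdot u v + cdot u w.
Proof. by rewrite /cdot mulmxDr mxE. Qed.

Lemma cdotZr (C : numClosedFieldType) (n : nat) (a : C) (u v : 'cV[C]_n) :
  cdot u (a *: v) = a * cdot u v.
Proof. by rewrite /cdot -scalemxAr mxE. Qed.

(** Passage from the Schrödinger to the Heisenberg picture: [V] crosses the scalar product as its
    adjoint [U], leaving [U A V] between two copies of [u]. *)
Lemma cdot_heisenberg (C : numClosedFieldType) (n : nat)
    (U V A M W : 'M[C]_n) (a c : C) (u : 'cV[C]_n) :
  (V^t*)%sesqui = U -> U *m A *m V = A + a *: M -> M = c *: W ->
  cdot (V *m u) (A *m (V *m u)) = cdot u (A *m u) + a * c * cdot u (W *m u).
Proof.
move=> VU UAV MW; rewrite -cdotZr -cdotDr scalemxAl -scalerA -MW -mulmxDl -UAV.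
by rewrite -VU /cdot trmx_mul map_mxM !mulmxA.
Qed.

(* [H^2 = (x - y)^2 + x y (A + B)^2], so that [x != y] keeps it positive. *)
Lemma sqr_hermitian_comb (R : realType) (A B : 'M[R[i]]_2) (x y : R) :
  A \is hermsymmx -> B \is hermsymmx ->
  eigenvalue A 1 -> eigenvalue A (-1) -> eigenvalue B 1 -> eigenvalue B (-1) ->
  0 < x -> 0 < y -> x != y ->
  let H := x%:C *: A + y%:C *: B in
  exists2 w : R, w != 0 & H *m H = (w ^+ 2)%:C%:M.
Proof.
move=> hA hB A1 AN1 B1 BN1 x0 y0 xy H.
have [trA sqA] := eigenvalue_pm1_mx22 A1 AN1.
have [trB sqB] := eigenvalue_pm1_mx22 B1 BN1.
have trH : H 1 1 = - H 0 0 by rewrite !mxE trA trB; ring.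
have sumE : H 0 0 ^+ 2 + H 0 1 * H 1 0 = (x - y)%:C ^+ 2 +
    (x * y)%:C * ((A 0 0 + B 0 0) ^+ 2 + (A 0 1 + B 0 1) * (A 0 1 + B 0 1)^*%R).
  have -> : (A 0 1 + B 0 1)^*%R = A 1 0 + B 1 0.
    by rewrite rmorphD /= (hermsymmx_conj 1 0 hA) (hermsymmx_conj 1 0 hB).
  rewrite !mxE rmorphB !rmorphM.
  (* The regrouping isolates the scalars of [A^2] and [B^2], both 1; what remains of them is
     [x^2 + y^2 - 2 x y]. *)
  transitivity (x%:C ^+ 2 * (A 0 0 ^+ 2 + A 0 1 * A 1 0)
    + y%:C ^+ 2 * (B 0 0 ^+ 2 + B 0 1 * B 1 0) +
    x%:C * y%:C * ((A 0 0 + B 0 0) ^+ 2 + (A 0 1 + B 0 1) * (A 1 0 + B 1 0)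
     - (A 0 0 ^+ 2 + A 0 1 * A 1 0) - (B 0 0 ^+ 2 + B 0 1 * B 1 0))).
    by ring.
  by rewrite sqA sqB; ring.
have sum_gt0 : 0 < H 0 0 ^+ 2 + H 0 1 * H 1 0.
  rewrite sumE; apply: ltr_wpDr.
    apply: mulr_ge0; first by rewrite lecR mulr_ge0 ?ltW.
    apply: addr_ge0; last exact: mul_conjC_ge0.
    (* The diagonal of a Hermitian matrix is real, so this square is nonnegative. *)
    rewrite real_exprn_even_ge0 //.
    by apply/CrealP; rewrite rmorphD /= -hermsymmx_conj // -hermsymmx_conj.
  by rewrite -rmorphXn ltcR exprn_even_gt0 //= subr_eq0.
have {sum_gt0} [r r0 rE] : exists2 r : R, 0 < r & H 0 0 ^+ 2 + H 0 1 * H 1 0 = r%:C.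
  case: (_ + _) sum_gt0 => a b; rewrite ltcE /= => /andP[/eqP -> a0].
  by exists a.
exists (Num.sqrt r); first by rewrite gt_eqF ?sqrtr_gt0.
by rewrite sqr_traceless_mx22 // rE sqr_sqrtr ?ltW.
Qed.

(** The factors 2 and [- 2^-1] cancel; they are kept apart because [- 2^-1 *: commutator F E] will
    be [H L]. *)
Lemma commutator_comb (F : numFieldType) (n : nat) (A B : 'M[F]_n) (a b : F) :
  commutator (a *: A + b *: B) B = (2 * a) *: (- 2^-1 *: commutator B A).
Proof.
rewrite scalerA mulrN mulrAC divff ?pnatr_eq0// mul1r scaleNr.
rewrite /commutator mulmxDl mulmxDr -!scalemxAl -!scalemxAr.
by rewrite opprD addrACA subrr addr0 -scalerBr -scalerN opprB.
Qed.

Lemma invr_2i_mulNi (C : numClosedFieldType) :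
  (2 * 'i%R)^-1 * - 'i%R = - 2^-1 :> C.
Proof. by rewrite invfM mulrN -mulrA mulVf ?neq0Ci// mulr1. Qed.

Lemma adjointZ (C : numClosedFieldType) (m n : nat) (a : C) (A : 'M[C]_(m, n)) :
  ((a *: A)^t* = a^*%R *: A^t*)%sesqui.
Proof. by apply/matrixP => i j; rewrite !mxE rmorphM. Qed.

Lemma adjoint_hermitian_comb (R : realType) (n : nat) (A B : 'M[R[i]]_n)
    (x y : R) :
  (A^t* = A -> B^t* = B ->
   (x%:C *: A + y%:C *: B)^t* = x%:C *: A + y%:C *: B)%sesqui.
Proof.
move=> hA hB; rewrite linearD map_mxD !adjointZ hA hB.
by congr (_ *: _ + _ *: _); exact: conjc_real.
Qed.

Lemma adjoint_hermitian_iZ (R : realType) (n : nat) (A : 'M[R[i]]_n) (x : R) :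
  (A^t* = A -> (('i%R * x%:C) *: A)^t* = - (('i%R * x%:C) *: A))%sesqui.
Proof.
move=> hA; rewrite adjointZ hA -scaleNr rmorphM /= conjCi -mulNr.
by congr (_ * _ *: _); exact: conjc_real.
Qed.

Lemma rho_mulmx (R : realType) (n m : nat) (t : R) (A : 'M[R[i]]_n.+1)
    (B : 'M[R[i]]_(n.+1, m)) :
  rho t A *m B = (2 * 'i%R)^-1 *:
    ((expmx ((2 * 'i%R * t%:C) *: A) - 1%:M) *m invmx A *m B).
Proof. by rewrite /rho -!scalemxAl. Qed.

(** * Heisenberg evolution of [F] and [E], and their expectation values *)

Theorem mainTheorem1 (R : realType) (F E : 'M[R[i]]_2) (wE wF : R)
    (hF : F \is hermsymmx) (hE : E \is hermsymmx)
    (F1 : eigenvalue F 1) (FN1 : eigenvalue F (-1))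
    (E1 : eigenvalue E 1) (EN1 : eigenvalue E (-1))
    (hFE : commutator F E != 0)
    (wE0 : 0 < wE) (wF0 : 0 < wF) (wEF : wE != wF) :
  let H : 'M[R[i]]_2 := wE%:C *: E + wF%:C *: F in
  let Z : 'M[R[i]]_2 := - 'i *: commutator F E in
  let U (t : R) : 'M[R[i]]_2 := expmx (('i * t%:C) *: H) in
  let V (t : R) : 'M[R[i]]_2 := expmx ((- 'i * t%:C) *: H) in
  H \in unitmx /\
  forall t : R, 0 <= t ->
    [/\ U t *m F *m V t = F + wE%:C *: (rho t H *m Z),
        U t *m E *m V t = E - wF%:C *: (rho t H *m Z)
      & forall Psi0 : 'cV[R[i]]_2, cnorm Psi0 = 1 ->
        let Psi : 'cV[R[i]]_2 := V t *m Psi0 in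
        let W : 'M[R[i]]_2 :=
          (expmx ((2 * 'i * t%:C) *: H) - 1%:M) *m invmx H *m Z in
        cdot Psi (F *m Psi)
          = cdot Psi0 (F *m Psi0) + wE%:C / (2 * 'i) * cdot Psi0 (W *m Psi0) /\
        cdot Psi (E *m Psi)
          = cdot Psi0 (E *m Psi0) - wF%:C / (2 * 'i) * cdot Psi0 (W *m Psi0)].
Proof.
move=> H Z U V.
have [w w0 HH] := sqr_hermitian_comb hE hF E1 EN1 F1 FN1 wE0 wF0 wEF.
rewrite -/H in HH.
have w2 : (w ^+ 2)%:C != 0 :> R[i] by rewrite fmorph_eq0 expf_neq0.
have Hu : H \in unitmx.
  (* As [H] squares to a nonzero scalar, its inverse is [H / w^2]. *)
  have /mulmx1_unit[] // : H *m ((w ^+ 2)%:C^-1 *: H) = 1%:M.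
  by rewrite -scalemxAr HH scale_scalar_mx mulVf.
split=> // t t0.
have [J JE] : exists J, J = ('i%R * (w^-1)%:C) *: H by eexists.
have JJ : J *m J = (-1)%:M.
  rewrite JE -scalemxAl -scalemxAr scalerA HH scale_scalar_mx mulrACA -expr2 sqrCi.
  by rewrite -rmorphM -mulrA -rmorphM (_ : _ * w ^+ 2 = 1) ?mulr1//; field.
(* Since [i H = w J], time [s] corresponds to the angle [s * w]. *)
have expE s : expmx (('i%R * s%:C) *: H) = expmx ((s * w)%:C *: J).
  by rewrite JE scalerA mulrCA -rmorphM mulfK.
have VE : V t = expmx ((- (t * w))%:C *: J).
  by rewrite /V -mulNr -expE rmorphN mulrN -mulNr.
have UE : U t = expmx ((t * w)%:C *: J) by exact: expE.
have U2E : expmx ((2 * 'i%R * t%:C) *: H) = expmx ((2 * (t * w))%:C *: J).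
  have -> : 2 * 'i%R * t%:C = 'i%R * (2 * t)%:C :> R[i].
    by rewrite rmorphM rmorph_nat mulrCA mulrA.
  by rewrite mulrA; exact: expE.
pose D := commutator F E.
have FF : F *m F = 1%:M.
  by have [tr0 sq1] := eigenvalue_pm1_mx22 F1 FN1; rewrite sqr_traceless_mx22 ?sq1.
have EE : E *m E = 1%:M.
  by have [tr0 sq1] := eigenvalue_pm1_mx22 E1 EN1; rewrite sqr_traceless_mx22 ?sq1.
have DF : D *m F = - (F *m D) by exact: anticommutator_commutator.
have DE : D *m E = - (E *m D).
  rewrite /D commutatorC mulNmx mulmxN opprK.
  by rewrite (anticommutator_commutator F EE) opprK.
have DH : D *m H = - (H *m D).
  rewrite [H *m D]mulmxDl [D *m H]mulmxDr -!scalemxAl -!scalemxAr DF DE.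
  by rewrite !scalerN opprD.
(* [L] is chosen so that [rho t H *m Z] is [e^{2itH} - 1] applied to [L]. *)
have [L LE] : exists L, L = (2 * 'i%R)^-1 *: (invmx H *m Z) by eexists.
have HL : H *m L = - 2^-1 *: D.
  rewrite LE -scalemxAr (mulKVmx Hu).
  by rewrite /Z scalerA invr_2i_mulNi.
have LH : L *m H = - (H *m L).
  (* After multiplication by [H] on the left, [H L] becomes a multiple of [D], which anticommutes
     with [H]. *)
  apply: (can_inj (mulKmx Hu)); rewrite mulmxA HL mulmxN.
  by rewrite -scalemxAl -scalemxAr DH scalerN.
have LJ : L *m J = - (J *m L).
  by rewrite JE -(scalemxAr _ L H) -(scalemxAl _ H L) LH scalerN.
have HF : H *m F - F *m H = (2 * wE%:C) *: (H *m L).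
  by rewrite HL; exact: commutator_comb.
have HE : H *m E - E *m H = (2 * - wF%:C) *: (H *m L).
  (* Exchanging [F] and [E] reverses the commutator, which accounts for the sign of [wF]. *)
  rewrite HL mulrN scaleNr -scalerN -scalerN /D -commutatorC.
  have -> : H = wF%:C *: F + wE%:C *: E by exact: addrC.
  exact: commutator_comb.
have J_comm A a : H *m A - A *m H = (2 * a) *: (H *m L) ->
    J *m A - A *m J = (2 * a) *: (J *m L).
  move=> HA; rewrite JE -!scalemxAl -scalemxAr -scalerBr HA !scalerA.
  by rewrite mulrC.
have rhoE : rho t H *m Z = (expmx ((2 * (t * w))%:C *: J) - 1%:M) *m L.
  by rewrite rho_mulmx U2E LE -[RHS]scalemxAr [in RHS]mulmxA.
have Ft : U t *m F *m V t = F + wE%:C *: (rho t H *m Z).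
  by rewrite UE VE rhoE; apply: expmx_complex_structure_conj LJ (J_comm _ _ HF).
(* The sign stays inside the scalar, the shape that both the conjugation lemma and [cdot_heisenberg]
   take. *)
have Et' : U t *m E *m V t = E + (- wF%:C) *: (rho t H *m Z).
  by rewrite UE VE rhoE; exact: expmx_complex_structure_conj LJ (J_comm _ _ HE).
have Et : U t *m E *m V t = E - wF%:C *: (rho t H *m Z).
  by rewrite Et' scaleNr.
split; [exact: Ft | exact: Et | move=> Psi0 _ Psi W].
have Hadj : (H^t* = H)%sesqui.
  exact: adjoint_hermitian_comb (hermsymmxE hE) (hermsymmxE hF).
have Jadj : (J^t* = - J)%sesqui by rewrite JE; exact: adjoint_hermitian_iZ.
have Vadj : ((V t)^t* = U t)%sesqui.
  rewrite UE VE.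
  have := adjoint_expmx_complex_structure JJ (- (t * w)) Jadj.
  by rewrite opprK.
have WE : rho t H *m Z = (2 * 'i%R)^-1 *: W.
  exact: rho_mulmx.
split; first exact: cdot_heisenberg Vadj Ft WE.
by rewrite (cdot_heisenberg Psi0 Vadj Et' WE) !mulNr.
Qed.
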